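(* Let $A\in\mathbb{R}^{n\times n}$, $B\in\mathbb{R}^{n\times m}$ with $m\le n$, let $W\subseteq\mathbb{R}^n$ be nonempty, and let $X\subseteq\mathbb{R}^n$ and $U\subseteq\mathbb{R}^m$ be compact. For every $\rho\in\mathbb{R}_{>0}$ there exists an index $i\in\mathbb{Z}_{\ge0}$ such that $$R_i^\rho\subseteq R_{i+1}^\rho+\rho\mathbb{B}$$ holds and $R_{i+1}^\rho$ is robust controlled invariant with respect to the system $\xi(t+1)\in A\xi(t)+B\nu(t)+W$ and $U$.
   Context: $\mathbb{B}$ denotes the closed unit ball of the infinity norm in $\mathbb{R}^n$. Sums of sets are Minkowski sums (a sum with the empty set is empty), and $x+W$ means $\{x\}+W$. For $\rho\in\mathbb{R}_{\ge0}$ and $R\subseteq\mathbb{R}^n$, $\operatorname{pre}_\rho(R)=\{x\in\mathbb{R}^n\mid \exists u\in U:\ Ax+Bu+W+\rho\mathbb{B}\subseteq R\}$. The sequence $(R_i^\rho)_{i\in\mathbb{Z}_{\ge0}}$ is defined by $R_0^\rho=X$, $R_{i+1}^\rho=\operatorname{pre}_\rho(R_i^\rho)\cap X$. A set $S\subseteq\mathbb{R}^n$ is robust controlled invariant with respect to the system $\xi(t+1)\in A\xi(t)+B\nu(t)+W$ and $U$ if for every $x\in S$ there exists $u\in U$ with $Ax+Bu+W\subseteq S$. (The empty set is robust controlled invariant.) *)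

(* Defs.v *)
(* MathComp-Analysis; vectors of R^n are column vectors 'cV[R]_n. *)
From mathcomp Require Export all_boot all_order all_algebra.
From mathcomp Require Export all_classical all_reals all_analysis.
Export numFieldNormedType.Exports.

Set Implicit Arguments.
Unset Strict Implicit.
Unset Printing Implicit Defensive.

Import Order.TTheory GRing.Theory Num.Theory.
Local Open Scope classical_set_scope.
Local Open Scope ring_scope.

Definition minkowski_sum (V : zmodType) (S T : set V) : set V :=
  [set x + y | x in S & y in T].

Notation "S <+> T" := (minkowski_sum S T)
  (at level 50, left associativity) : classical_set_scope.

(* The norm of MathComp-Analysis on matrices is the largest absolute value of
   an entry, i.e. the infinity norm on column vectors. *)
Definition unit_ball (R : realType) (n : nat) : set 'cV[R]_n :=
  [set x | `|x| <= 1].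

Definition scaled_ball (R : realType) (n : nat) (rho : R) : set 'cV[R]_n :=
  [set rho *: x | x in @unit_ball R n].

Definition pre (R : realType) (n m : nat) (A : 'M[R]_n) (B : 'M[R]_(n, m))
    (W : set 'cV[R]_n) (U : set 'cV[R]_m) (rho : R) (S : set 'cV[R]_n) :
    set 'cV[R]_n :=
  [set x | exists2 u, U u &
     [set A *m x + B *m u] <+> W <+> @scaled_ball R n rho `<=` S].

Fixpoint pre_iter (R : realType) (n m : nat) (A : 'M[R]_n) (B : 'M[R]_(n, m))
    (W X : set 'cV[R]_n) (U : set 'cV[R]_m) (rho : R) (i : nat) :
    set 'cV[R]_n :=
  if i is j.+1 then pre A B W U rho (pre_iter A B W X U rho j) `&` X else X.

Definition robust_controlled_invariant (R : realType) (n m : nat)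
    (A : 'M[R]_n) (B : 'M[R]_(n, m)) (W : set 'cV[R]_n) (U : set 'cV[R]_m)
    (S : set 'cV[R]_n) : Prop :=
  forall x, S x -> exists2 u, U u & [set A *m x + B *m u] <+> W `<=` S.

(* Main.v *)
Require Import Defs.
From mathcomp Require Import finmap.

(** Let [C_i] be the set of points whose closed [rho]-ball lies in [R_i], so
    that [R_(i+1)] consists of the points of [X] that some input steers into
    [C_i] under every disturbance. Cover [X] by finitely many balls of radius
    [rho / 2]. As [R_i] and [C_i] decrease, the families of balls that they
    meet are eventually constant, and from then on [R_i] and [C_i] lie within
    distance [rho] of [R_(i+1)] and [C_(i+1)] respectively. But a point within
    distance [rho] of [C_(i+1)] belongs to [R_(i+1)], so
    [C_i `<=` R_(i+1)], which is robust controlled invariance of [R_(i+1)]. *)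

Set Implicit Arguments.
Unset Strict Implicit.
Unset Printing Implicit Defensive.

Import Order.TTheory GRing.Theory Num.Theory.
Local Open Scope classical_set_scope.
Local Open Scope ring_scope.

(** Either every [S i] meets [K], or some [S N] misses it; in the latter case all later sets miss
    [K] too and the implication is vacuous. *)
Lemma nonincreasing_meet_eventually (T : Type) (S : nat -> set T) (K : set T) :
  (forall i, S i.+1 `<=` S i) ->
  \forall i \near \oo, S i `&` K !=set0 -> S i.+1 `&` K !=set0.
Proof.
move=> S_decr.
have S_anti i j : (i <= j)%N -> S j `<=` S i.
  move=> /subnK <-; elim: (j - i)%N => //= k IHk.
  by rewrite addSn; exact: subset_trans IHk.
have [meets|/existsNP[N missN]] := pselect (forall i, S i `&` K !=set0).
  by near=> i.
near=> i => -[x [Six Kx]]; exfalso; apply: missN; exists x; split => //.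
by apply: S_anti Six; near: i; exact: nbhs_infty_ge.
Unshelve. all: by end_near. Qed.

Lemma compact_nonincreasing_close (R : realType) (V : normedModType R)
    (X : set V) (S : nat -> set V) (e : R) :
  compact X -> (forall i, S i `<=` X) -> (forall i, S i.+1 `<=` S i) -> 0 < e ->
  \forall i \near \oo, forall x, S i x -> exists2 y, S i.+1 y & ball x e y.
Proof.
move=> X_compact SX S_decr e_gt0.
have e2_gt0 : 0 < e / 2 by rewrite divr_gt0.
move: X_compact; rewrite compact_cover.
(* Interiors, since the covering form of compactness asks for open sets. *)
move=> /(_ V setT (fun c => (ball c (e / 2))^°)).
case=> [c _|x _|D _ XD]; first exact: open_interior.
  by exists x => //; exact: nbhsx_ballx.
(* Finiteness of [D] gives one threshold valid for all the balls at once. *)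
have : \forall i \near \oo, (\bigcap_(c in [set` D])
    [set i | S i `&` ball c (e / 2) !=set0 ->
             S i.+1 `&` ball c (e / 2) !=set0]) i.
  by apply: filter_bigI => c _; exact: nonincreasing_meet_eventually.
apply: filterS => i meet x Six.
have [c cD /interior_subset cx] := XD x (SX i x Six).
have [y [Sy cy]] := meet c cD (ex_intro _ x (conj Six cx)).
by exists y => //; apply: ball_split cy; exact: ball_sym.
Qed.

(** The Minkowski (Pontryagin) difference of [S] and [T]. *)
Definition erosion (V : zmodType) (S T : set V) : set V :=
  [set x | [set x] <+> T `<=` S].

(** An adjunction, used to move the ball in [pre] from the successor set to the target. *)
Lemma minkowski_sum_sub_erosion (V : zmodType) (S T Z : set V) :
  S <+> T `<=` Z <-> S `<=` erosion Z T.
Proof.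
split=> [STZ x Sx z [_ -> [y Ty <-]]|SZ z [x Sx [y Ty <-]]].
  by apply: STZ; exists x => //; exists y.
by apply: (SZ x Sx); exists x => //; exists y.
Qed.

Lemma erosion_subset (V : zmodType) (S S' T : set V) :
  S `<=` S' -> erosion S T `<=` erosion S' T.
Proof. by move=> SS' x /subset_trans; exact. Qed.

Lemma scaled_ballP (R : realType) (n : nat) (rho : R) (x : 'cV[R]_n) :
  0 < rho -> scaled_ball rho x <-> `|x| <= rho.
Proof.
move=> rho_gt0; split=> [[y y1 <-]|x_rho].
  by rewrite normrZ gtr0_norm// ger_pMr.
exists (rho^-1 *: x); last by rewrite scalerA divff ?scale1r// gt_eqF.
by rewrite /unit_ball/= normrZ gtr0_norm ?invr_gt0// ler_pdivrMl// mulr1.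
Qed.

Lemma erosion_scaled_ballP (R : realType) (n : nat) (rho : R)
    (S : set 'cV[R]_n) (x : 'cV[R]_n) : 0 < rho ->
  erosion S (scaled_ball rho) x <-> forall y, `|x - y| <= rho -> S y.
Proof.
move=> rho_gt0; split=> [xS y xy|xS _ [_ -> [b /scaled_ballP bS <-]]].
  apply: xS; exists x => //; exists (y - x); last by rewrite addrC subrK.
  by apply/scaled_ballP => //; rewrite distrC.
by apply: xS; rewrite opprD addNKr normrN; exact: bS.
Qed.

Section PreIter.
Variables (R : realType) (n m : nat) (A : 'M[R]_n) (B : 'M[R]_(n, m)).
Variables (W X : set 'cV[R]_n) (U : set 'cV[R]_m) (rho : R).

Local Notation erode S := (erosion S (scaled_ball rho)).
Local Notation iter := (pre_iter A B W X U rho).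

(** In this form the condition on [u] is that of robust controlled invariance, with target
    [erode S]. *)
Lemma preE (S : set 'cV[R]_n) : pre A B W U rho S =
  [set x | exists2 u, U u & [set A *m x + B *m u] <+> W `<=` erode S].
Proof.
apply/seteqP; split=> x [u Uu uS]; exists u => //.
  exact: (iffLR (minkowski_sum_sub_erosion _ _ _)).
exact: (iffRL (minkowski_sum_sub_erosion _ _ _)).
Qed.

Lemma pre_subset (S S' : set 'cV[R]_n) :
  S `<=` S' -> pre A B W U rho S `<=` pre A B W U rho S'.
Proof. by move=> SS' x [u Uu /subset_trans uS]; exists u => //; exact: uS. Qed.

Lemma pre_iter_subset (i : nat) : iter i `<=` X.
Proof. by case: i => // i x []. Qed.

Lemma pre_iter_nonincreasing (i : nat) : iter i.+1 `<=` iter i.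
Proof.
elim: i => [|i IHi] x; first by case.
by case=> ix Xx; split=> //; exact: pre_subset ix.
Qed.

(** The input that puts [x] in [iter i.+1] steers it into [erode (iter i)], hence back into
    [iter i.+1]. *)
Lemma robust_controlled_invariant_pre_iter (i : nat) :
  erode (iter i) `<=` iter i.+1 ->
  robust_controlled_invariant A B W U (iter i.+1).
Proof.
move=> eroded x [+ _]; rewrite preE => -[u Uu uW].
by exists u => //; exact: subset_trans eroded.
Qed.

End PreIter.

Theorem theorem2 (R : realType) (n m : nat) (m_le_n : (m <= n)%N)
    (A : 'M[R]_n) (B : 'M[R]_(n, m))
    (W : set 'cV[R]_n) (W_neq0 : W !=set0)
    (X : set 'cV[R]_n) (X_compact : compact X)
    (U : set 'cV[R]_m) (U_compact : compact U)
    (rho : R) (rho_gt0 : 0 < rho) :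
  exists i : nat,
    pre_iter A B W X U rho i
      `<=` pre_iter A B W X U rho i.+1 <+> @scaled_ball R n rho /\
    robust_controlled_invariant A B W U (pre_iter A B W X U rho i.+1).
Proof.
pose S := pre_iter A B W X U rho.
pose C i := erosion (S i) (scaled_ball rho).
have SX i : S i `<=` X by exact: pre_iter_subset.
have S_decr i : S i.+1 `<=` S i by exact: pre_iter_nonincreasing.
have CX i : C i `<=` X.
  move=> x /erosion_scaled_ballP Cx; apply: (SX i); apply: Cx => //.
  by rewrite subrr normr0 ltW.
have C_decr i : C i.+1 `<=` C i by exact: erosion_subset.
have Sclose := @compact_nonincreasing_close R 'cV[R]_n _ _ _
  X_compact SX S_decr rho_gt0.
have Cclose := @compact_nonincreasing_close R 'cV[R]_n _ _ _
  X_compact CX C_decr rho_gt0.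
(* Both properties hold eventually, so some index has both. *)
have [i [{}Sclose {}Cclose]] := @filter_ex _ _ _ _ (filterI Sclose Cclose).
exists i; split=> [x /Sclose[y Sy]|].
  rewrite -ball_normE => /ltW xy; exists y => //; exists (x - y).
    exact/scaled_ballP.
  by rewrite addrC subrK.
apply: robust_controlled_invariant_pre_iter => x /Cclose[y Cy].
rewrite -ball_normE => /ltW xy.
by move: Cy => /erosion_scaled_ballP; apply => //; rewrite distrC.
Qed.
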